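(* Let $G=\sum_{n=0}^{\infty}\frac{(-1)^n}{(2n+1)^2}$ be Catalan's constant. The following summation formulas hold: $${}_{4}F_{3}\left(\begin{array}{c}1,\,1,\,3/2,\,3/2\\ 2,\,2,\,3\end{array};\,1\right)=8+32\log 2-64\,\frac{G}{\pi}-\frac{32}{\pi},$$ $${}_{4}F_{3}\left(\begin{array}{c}1,\,1,\,3/2,\,3/2\\ 2,\,3,\,3\end{array};\,1\right)=96+64\log 2-128\,\frac{G}{\pi}-\frac{320}{\pi},$$ $${}_{4}F_{3}\left(\begin{array}{c}1,\,1,\,3/2,\,3/2\\ 2,\,2,\,4\end{array};\,1\right)=18+48\log 2-96\,\frac{G}{\pi}-\frac{208}{3\pi}.$$
   Context: $\log$ is the natural logarithm. The generalized hypergeometric function ${}_4F_3$ is defined by the power series $${}_4F_3\left(\begin{array}{c}a_1,a_2,a_3,a_4\\ b_1,b_2,b_3\end{array};x\right)=\sum_{k=0}^{\infty}\frac{(a_1)_k(a_2)_k(a_3)_k(a_4)_k}{(b_1)_k(b_2)_k(b_3)_k}\frac{x^k}{k!}$$ for $|x|<1$, where $(a)_k=a(a+1)\cdots(a+k-1)$ (with $(a)_0=1$) is the Pochhammer symbol (increasing factorial). The series also converges at $x=1$ whenever $\mathrm{Re}(b_1+b_2+b_3-a_1-a_2-a_3-a_4)>0$, and the value at $x=1$ is then the sum of the series there. *)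

(* Defs.v *)
From Stdlib Require Import Reals Factorial.
From Coquelicot Require Import Coquelicot.
Open Scope R_scope.

Fixpoint pochhammer (a : R) (k : nat) : R :=
  match k with
  | O => 1
  | S k' => pochhammer a k' * (a + INR k')
  end.

(** Coefficient of [x ^ k] in the series; meaningful only when none of
    [b1], [b2], [b3] is a nonpositive integer. *)
Definition hyp4F3_coef (a1 a2 a3 a4 b1 b2 b3 : R) (k : nat) : R :=
  (pochhammer a1 k * pochhammer a2 k * pochhammer a3 k * pochhammer a4 k)
  / (pochhammer b1 k * pochhammer b2 k * pochhammer b3 k)
  / INR (fact k).

(** [PSeries] is a total function: its value is the sum of the series only
    where [ex_pseries] holds, so convergence has to be asserted separately. *)
Definition hyp4F3 (a1 a2 a3 a4 b1 b2 b3 x : R) : R :=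
  PSeries (hyp4F3_coef a1 a2 a3 a4 b1 b2 b3) x.

Definition hyp4F3_cv (a1 a2 a3 a4 b1 b2 b3 x : R) : Prop :=
  ex_pseries (hyp4F3_coef a1 a2 a3 a4 b1 b2 b3) x.

Definition Catalan : R :=
  Series (fun n : nat => (-1) ^ n / (2 * INR n + 1) ^ 2).

(* Main.v *)
Require Import Defs.
From Stdlib Require Import Reals Factorial Lra Lia.
From Coquelicot Require Import Coquelicot.
Open Scope R_scope.

(** Write [w n] for [wallis n], the number (1/2)_n / n! = C(2n, n) / 4^n.
    Putting n = k + 1, the k-th terms of the three series are
    8 w_n^2 / (n (n+1)), 16 w_n^2 / (n (n+1)^2) and
    24 w_n^2 / (n (n+1) (n+2)).  In partial fractions each of them is a
    multiple of w_n^2 / n plus a combination of w_n^2 / (n+1),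
    w_n^2 / (n+1)^2 and w_n^2 / (n+2).  The last three are differences
    p(n+1) w_(n+1)^2 - p(n) w_n^2 with p(n) = 4 n, 16 n + 4 and
    n (20 n + 16) / (9 (n+1)) respectively, so their sums follow from Wallis'
    limit n w_n^2 -> 1 / PI ([wallis_limit]).  They produce the rational
    terms and those in 1 / PI; the terms in ln 2 and G / PI come from
    the sum over n >= 1 of w_n^2 / n = 4 ln 2 - 8 G / PI
    ([is_series_wallis_sq_div]).

    For that sum, write one factor w_n as 2 / PI times the integral of
    sin^(2n) over [0, PI/2] and integrate by parts:
    w_n / n is 4 / PI times the integral of (PI/2 - t) sin^(2n-1) t cos t.
    Since the sum over n >= 0 of w_n sin^(2n) t is 1 / cos t, the sum over
    n >= 1 of w_n sin^(2n-1) t cos t is (1 - cos t) / sin t = tan (t/2), and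
    the series equals 4 / PI times the integral of (PI/2 - t) tan (t/2)
    ([is_series_wallis_sq_div_of_RInt]).  The convergence to 1 / cos t is not
    uniform near PI/2, but the factor PI/2 - t, which vanishes there, makes
    the remainder O(w_N) uniformly ([sec_defect_bounds]).

    Finally tan (t/2) has the (Abel-summable) sine expansion
    2 (sin t - sin 2t + sin 3t - ...), and the integral of
    (PI/2 - t) sin kt is PI / (2k) - sin (k PI/2) / k^2.  Summing, the first
    parts give PI ln 2 and the second ones, which survive for odd k only,
    give - 2 G ([is_RInt_compl_mul_tan_half]).  The partial sums differ from
    tan (t/2) by an oscillating kernel whose contribution is O(1/N)
    ([oscillating_remainder_bound]). *)

(** * Calculus preliminaries *)

(** Equations produced by the abstract module structures are stated at a
    carrier that reduces to [R], which [ring] and [field] do not see through. *)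
Ltac at_R :=
  repeat (unfold plus, minus, opp, scal, mult, zero; simpl);
  lazymatch goal with
  | |- @eq _ ?a ?b => change (@eq R a b)
  | |- _ => idtac
  end.

Lemma is_RInt_of_antiderivative (F f : R -> R) (a b : R) :
  a <= b ->
  (forall x, a <= x <= b -> is_derive F x (f x)) ->
  (forall x, a <= x <= b -> ex_derive f x) ->
  is_RInt f a b (F b - F a).
Proof.
  intros Hab HF Hf.
  apply (is_RInt_derive (V := R_CompleteNormedModule) F f);
    intros x; rewrite Rmin_left, Rmax_right by lra; intros Hx.
  - now apply HF.
  - now apply (ex_derive_continuous f), Hf.
Qed.

Lemma nondecreasing_of_derive_nonneg (F f : R -> R) (a b : R) :
  a <= b ->
  (forall x, a <= x <= b -> is_derive F x (f x)) ->
  (forall x, a <= x <= b -> 0 <= f x) ->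
  F a <= F b.
Proof.
  intros Hab HF Hf.
  destruct (MVT_gen F a b f) as [c [Hc Heq]];
    rewrite ?Rmin_left, ?Rmax_right in * by lra.
  - intros x Hx; apply HF; lra.
  - intros x Hx; apply continuity_pt_filterlim.
    apply (ex_derive_continuous F); exists (f x); now apply HF.
  - assert (0 <= f c * (b - a)) by (apply Rmult_le_pos; [apply Hf|]; lra).
    lra.
Qed.

(** A crude form of Jordan's inequality, read off the cubic Taylor bound:
    x <= 2 gives sin x >= x (1 - 4/6). *)
Lemma le_3_sin (x : R) : 0 <= x <= PI / 2 -> x <= 3 * sin x.
Proof.
  intros Hx.
  pose proof PI_4 as H4.
  destruct (sin_bound x 0) as [Hs _]; try lra.
  unfold sin_approx, sin_term in Hs; simpl in Hs.
  assert (x * x <= 4) by nra.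
  assert (x * (x * x) <= x * 4) by nra.
  lra.
Qed.

Lemma sin_half_double (t : R) : sin t = 2 * sin (t / 2) * cos (t / 2).
Proof. rewrite <- sin_2a; f_equal; lra. Qed.

Lemma cos_half_double (t : R) : cos t = 2 * cos (t / 2) * cos (t / 2) - 1.
Proof. rewrite <- cos_2a_cos; f_equal; lra. Qed.

(** * Wallis' integrals and the asymptotics of the central binomial ratio *)

Definition wallis (n : nat) : R := pochhammer (1 / 2) n / INR (fact n).

Lemma wallis_0 : wallis 0 = 1.
Proof. unfold wallis; simpl; field. Qed.

Lemma wallis_S (n : nat) : wallis (S n) = wallis n * (2 * INR n + 1) / (2 * INR n + 2).
Proof.
  unfold wallis.
  rewrite fact_simpl, mult_INR, S_INR; simpl pochhammer.
  pose proof (pos_INR n); pose proof (INR_fact_neq_0 n).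
  field; split; lra.
Qed.

Lemma wallis_pos (n : nat) : 0 < wallis n.
Proof.
  induction n as [|n IH].
  - rewrite wallis_0; lra.
  - rewrite wallis_S; pose proof (pos_INR n).
    apply Rdiv_lt_0_compat; [apply Rmult_lt_0_compat|]; lra.
Qed.

Lemma INR_double (n : nat) : INR (2 * n) = 2 * INR n.
Proof. rewrite mult_INR; simpl; lra. Qed.

(** The reduction formula for Wallis' integrals: the combination
    (n+2) sin^(n+2) - (n+1) sin^n is the derivative of - sin^(n+1) cos, which
    vanishes at both ends. *)
Lemma is_RInt_sin_pow_step (n : nat) (I : R) :
  is_RInt (fun t => sin t ^ n) 0 (PI / 2) I ->
  is_RInt (fun t => sin t ^ (n + 2)) 0 (PI / 2)
    ((INR n + 1) / (INR n + 2) * I).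
Proof.
  intros HI.
  pose proof PI_RGT_0 as Hpi; pose proof (pos_INR n) as Hn.
  assert (HD : is_RInt (fun t => (INR n + 2) * sin t ^ (n + 2)
                                 - (INR n + 1) * sin t ^ n) 0 (PI / 2) 0).
  { assert (Hend : - (sin (PI / 2) ^ (n + 1) * cos (PI / 2))
                    - - (sin 0 ^ (n + 1) * cos 0) = 0).
    { rewrite cos_PI2, sin_0, pow_i by lia; ring. }
    rewrite <- Hend at 2.
    apply (is_RInt_of_antiderivative (fun t => - (sin t ^ (n + 1) * cos t)));
      [lra| |].
    - intros x _; auto_derive; [easy|].
      replace (Nat.pred (n + 1)) with n by lia.
      rewrite !pow_add, plus_INR; simpl.
      pose proof (sin2_cos2 x) as H; unfold Rsqr in H.
      replace (cos x) with (1 * cos x) by ring.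
      assert (Hc : cos x * cos x = 1 - sin x * sin x) by lra.
      transitivity (sin x ^ n * sin x * sin x
                    - (INR n + 1) * sin x ^ n * (cos x * cos x)); [ring|].
      rewrite Hc; ring.
    - intros x _; auto_derive; easy. }
  apply (is_RInt_scal _ _ _ (INR n + 1)) in HI.
  pose proof (is_RInt_plus _ _ _ _ _ _ HD HI) as HS.
  apply (is_RInt_scal _ _ _ (/ (INR n + 2))) in HS.
  unfold scal, plus in HS; simpl in HS; unfold mult in HS; simpl in HS.
  replace ((INR n + 1) / (INR n + 2) * I)
    with (/ (INR n + 2) * (0 + (INR n + 1) * I)) by (field; lra).
  revert HS; apply is_RInt_ext; intros x _; at_R; field; lra.
Qed.

Lemma is_RInt_sin_pow_even (n : nat) :
  is_RInt (fun t => sin t ^ (2 * n)) 0 (PI / 2) (PI / 2 * wallis n).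
Proof.
  induction n as [|n IH].
  - rewrite wallis_0.
    replace (PI / 2 * 1) with (scal (PI / 2 - 0) 1)
      by (unfold scal; simpl; unfold mult; simpl; ring).
    apply (is_RInt_const (V := R_NormedModule)).
  - replace (2 * S n)%nat with (2 * n + 2)%nat by lia.
    apply is_RInt_sin_pow_step in IH.
    rewrite INR_double in IH.
    rewrite wallis_S; pose proof (pos_INR n).
    replace (PI / 2 * (wallis n * (2 * INR n + 1) / (2 * INR n + 2)))
      with ((2 * INR n + 1) / (2 * INR n + 2) * (PI / 2 * wallis n))
      by (field; lra).
    exact IH.
Qed.

Lemma is_RInt_sin_pow_odd (n : nat) :
  is_RInt (fun t => sin t ^ (2 * n + 1)) 0 (PI / 2)
    (/ ((2 * INR n + 1) * wallis n)).
Proof.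
  induction n as [|n IH].
  - rewrite wallis_0.
    replace (/ ((2 * INR 0 + 1) * 1)) with (- cos (PI / 2) - - cos 0).
    2:{ rewrite cos_PI2, cos_0; simpl; field. }
    pose proof PI_RGT_0.
    apply (is_RInt_of_antiderivative (fun t => - cos t)); [lra| |];
      intros x _; auto_derive; easy || (simpl; ring).
  - replace (2 * S n + 1)%nat with (2 * n + 1 + 2)%nat by lia.
    apply is_RInt_sin_pow_step in IH.
    rewrite plus_INR, INR_double in IH; simpl (INR 1) in IH.
    rewrite wallis_S, S_INR; pose proof (pos_INR n); pose proof (wallis_pos n).
    replace (/ ((2 * (INR n + 1) + 1)
                * (wallis n * (2 * INR n + 1) / (2 * INR n + 2))))
      with ((2 * INR n + 1 + 1) / (2 * INR n + 1 + 2)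
            * / ((2 * INR n + 1) * wallis n))
      by (field; repeat split; lra).
    exact IH.
Qed.

Lemma sin_pow_succ_le (t : R) (n : nat) :
  0 <= t <= PI / 2 -> sin t ^ S n <= sin t ^ n.
Proof.
  intros Ht; pose proof PI_RGT_0.
  assert (0 <= sin t) by (apply sin_ge_0; lra).
  pose proof (SIN_bound t).
  pose proof (pow_le (sin t) n ltac:(lra)).
  simpl; nra.
Qed.

(** Integrals of powers of sine decrease with the exponent.  Comparing the
    even exponent 2n with its two odd neighbours encloses w_n^2. *)
Lemma wallis_bounds (n : nat) :
  2 * INR n / (2 * INR n + 1) <= PI * (INR n * wallis n ^ 2) <= 1.
Proof.
  pose proof PI_RGT_0 as Hpi; pose proof (pos_INR n) as Hn.
  pose proof (wallis_pos n) as Hu.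
  split.
  - assert (H : / ((2 * INR n + 1) * wallis n) <= PI / 2 * wallis n).
    { apply (is_RInt_le (fun t => sin t ^ (2 * n + 1))
               (fun t => sin t ^ (2 * n)) 0 (PI / 2)); [lra| | |].
      - apply is_RInt_sin_pow_odd.
      - apply is_RInt_sin_pow_even.
      - intros x Hx; rewrite Nat.add_1_r; apply sin_pow_succ_le; lra. }
    apply (Rmult_le_compat_l (2 * INR n * wallis n)) in H.
    2:{ apply Rmult_le_pos; lra. }
    replace (2 * INR n / (2 * INR n + 1))
      with (2 * INR n * wallis n * / ((2 * INR n + 1) * wallis n)) by (field; lra).
    replace (PI * (INR n * wallis n ^ 2))
      with (2 * INR n * wallis n * (PI / 2 * wallis n)) by (simpl; field).
    exact H.
  - destruct n as [|n]; [simpl; lra|].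
    assert (H : PI / 2 * wallis (S n) <= / ((2 * INR n + 1) * wallis n)).
    { apply (is_RInt_le (fun t => sin t ^ (2 * S n))
               (fun t => sin t ^ (2 * n + 1)) 0 (PI / 2)); [lra| | |].
      - apply is_RInt_sin_pow_even.
      - apply is_RInt_sin_pow_odd.
      - intros x Hx; replace (2 * S n)%nat with (S (2 * n + 1)) by lia.
        apply sin_pow_succ_le; lra. }
    pose proof (wallis_pos n) as Hun; pose proof (pos_INR n) as Hn'.
    apply (Rmult_le_compat_l (2 * INR (S n) * wallis (S n))) in H.
    2:{ apply Rmult_le_pos; lra. }
    replace (PI * (INR (S n) * wallis (S n) ^ 2))
      with (2 * INR (S n) * wallis (S n) * (PI / 2 * wallis (S n))) by (simpl; field).
    replace 1 with (2 * INR (S n) * wallis (S n) * / ((2 * INR n + 1) * wallis n)).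
    exact H.
    rewrite wallis_S, S_INR; field; repeat split; lra.
Qed.

Lemma is_lim_seq_inv_INR_affine (a b : R) :
  0 < a -> is_lim_seq (fun n => / (a * INR n + b)) 0.
Proof.
  intros Ha.
  change (Finite 0) with (Rbar_inv p_infty).
  apply is_lim_seq_inv; [|easy].
  eapply is_lim_seq_plus.
  - eapply is_lim_seq_mult; [apply is_lim_seq_const|apply is_lim_seq_INR|].
    now apply is_Rbar_mult_sym, is_Rbar_mult_p_infty_pos.
  - apply is_lim_seq_const.
  - reflexivity.
Qed.

Lemma wallis_limit : is_lim_seq (fun n => INR n * wallis n ^ 2) (/ PI).
Proof.
  pose proof PI_RGT_0 as Hpi.
  apply is_lim_seq_le_le
    with (u := fun n => / PI * (1 - / (2 * INR n + 1))) (w := fun _ => / PI).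
  - intros n; destruct (wallis_bounds n) as [H1 H2].
    pose proof (pos_INR n) as Hn.
    split; apply (Rmult_le_reg_l PI); try lra.
    + replace (PI * (/ PI * (1 - / (2 * INR n + 1))))
        with (2 * INR n / (2 * INR n + 1)) by (field; lra).
      exact H1.
    + now rewrite Rinv_r by lra.
  - replace (Finite (/ PI)) with (Rbar_mult (/ PI) (1 - 0))
      by (simpl; f_equal; ring).
    apply is_lim_seq_scal_l, is_lim_seq_minus'.
    + apply is_lim_seq_const.
    + apply is_lim_seq_inv_INR_affine; lra.
  - apply is_lim_seq_const.
Qed.

Lemma is_lim_seq_wallis : is_lim_seq wallis 0.
Proof.
  assert (H2 : is_lim_seq (fun n => wallis (S n) ^ 2) 0).
  { apply is_lim_seq_ext
      with (fun n => (INR (S n) * wallis (S n) ^ 2) * / (1 * INR n + 1)).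
    - intros n; rewrite S_INR; pose proof (pos_INR n); field; lra.
    - replace (Finite 0) with (Finite (/ PI * 0)) by (f_equal; ring).
      apply is_lim_seq_mult'.
      + apply (is_lim_seq_incr_1 (fun n => INR n * wallis n ^ 2)), wallis_limit.
      + apply is_lim_seq_inv_INR_affine; lra. }
  apply is_lim_seq_incr_1.
  apply is_lim_seq_ext with (fun n => sqrt (wallis (S n) ^ 2)).
  - intros n; apply sqrt_pow2; left; apply wallis_pos.
  - rewrite <- sqrt_0.
    apply is_lim_seq_continuous; [apply continuity_pt_sqrt; lra|exact H2].
Qed.

(** * Reduction of the sum of w_n^2 / n to an integral *)

(** Integration by parts from the even Wallis integral: the boundary term
    (PI/2 - t) sin^(2n+2) t vanishes at both ends of the interval. *)
Lemma is_RInt_compl_mul_sin_pow_cos (n : nat) :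
  is_RInt (fun t => (PI / 2 - t) * (sin t ^ (2 * n + 1) * cos t)) 0 (PI / 2)
    (PI / 4 * (wallis (S n) / INR (S n))).
Proof.
  pose proof PI_RGT_0 as Hpi; pose proof (pos_INR n) as Hn.
  pose proof (is_RInt_sin_pow_even (S n)) as HS.
  replace (2 * S n)%nat with (2 * n + 2)%nat in HS by lia.
  (* F is the boundary term; its derivative is the integrand minus the multiple
     of sin^(2n+2) handled by the even Wallis integral. *)
  set (a := / (2 * INR n + 2)).
  set (F := fun t => a * ((PI / 2 - t) * sin t ^ (2 * n + 2))).
  assert (HD : is_RInt (fun t => (PI / 2 - t) * (sin t ^ (2 * n + 1) * cos t)
                                 - a * sin t ^ (2 * n + 2))
                 0 (PI / 2) (F (PI / 2) - F 0)).
  { apply is_RInt_of_antiderivative; [lra| |].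
    - intros x _; unfold F; auto_derive; [easy|].
      replace (Nat.pred (n + (n + 0) + 2)) with (n + (n + 0) + 1)%nat by lia.
      simpl Nat.mul.
      rewrite !plus_INR, !pow_add; simpl INR; simpl pow.
      unfold a; field; lra.
    - intros x _; auto_derive; easy. }
  apply (is_RInt_scal _ _ _ a) in HS.
  pose proof (is_RInt_plus _ _ _ _ _ _ HD HS) as H.
  replace (PI / 4 * (wallis (S n) / INR (S n)))
    with (plus (F (PI / 2) - F 0) (scal a (PI / 2 * wallis (S n)))).
  - revert H; apply is_RInt_ext; intros x _; at_R; ring.
  - unfold F; rewrite sin_0, pow_i by lia.
    rewrite S_INR; at_R; unfold a; field; lra.
Qed.

Definition sec_partial_sum (N : nat) (t : R) : R :=
  sum_n (fun n => wallis n * sin t ^ (2 * n)) N.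

(** The series sum_n w_n sin^(2n) t is 1 / cos t, so this is the relative error
    of its partial sum; multiplying by the cosine keeps it smooth at PI/2. *)
Definition sec_defect (N : nat) (t : R) : R := 1 - cos t * sec_partial_sum N t.

(** The derivative telescopes because (2n+1) w_n = (2n+2) w_(n+1), which leaves
    the last term alone. *)
Lemma is_derive_sec_defect (N : nat) (t : R) :
  is_derive (sec_defect N) t ((2 * INR N + 1) * wallis N * sin t ^ (2 * N + 1)).
Proof.
  induction N as [|N IH].
  - apply is_derive_ext with (fun t => 1 - cos t).
    + intros x; unfold sec_defect, sec_partial_sum; rewrite sum_O, wallis_0.
      simpl; ring.
    + rewrite wallis_0; auto_derive; [easy|simpl; ring].
  - apply is_derive_ext
      with (fun x => sec_defect N x - wallis (S N) * (cos x * sin x ^ (2 * S N))).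
    { intros x; unfold sec_defect, sec_partial_sum; rewrite sum_Sn; at_R; ring. }
    (* d is the derivative of the term by which the defect decreases. *)
    set (d := wallis (S N) * ((2 * INR N + 2) * sin t ^ (2 * N + 1) * (cos t * cos t)
                - sin t ^ (2 * N + 1) * (sin t * sin t))).
    replace ((2 * INR (S N) + 1) * wallis (S N) * sin t ^ (2 * S N + 1))
      with ((2 * INR N + 1) * wallis N * sin t ^ (2 * N + 1) - d).
    + apply (is_derive_minus (sec_defect N)); [exact IH|].
      replace (2 * S N)%nat with (2 * N + 2)%nat by lia.
      auto_derive; [easy|].
      replace (Nat.pred (N + (N + 0) + 2)) with (N + (N + 0) + 1)%nat by lia.
      unfold d; simpl Nat.mul.
      rewrite !plus_INR, !pow_add; simpl INR.
      simpl pow; ring.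
    + unfold d.
      replace (2 * S N + 1)%nat with (2 * N + 1 + 2)%nat by lia.
      rewrite (pow_add (sin t) (2 * N + 1) 2), S_INR.
      pose proof (pos_INR N) as HN.
      assert (Hu : (2 * INR N + 1) * wallis N = (2 * INR N + 2) * wallis (S N))
        by (rewrite wallis_S; field; lra).
      assert (Hc : cos t * cos t = 1 - sin t * sin t)
        by (pose proof (sin2_cos2 t) as H; unfold Rsqr in H; lra).
      rewrite Hu, Hc; ring.
Qed.

Lemma sec_defect_0 (N : nat) : sec_defect N 0 = 0.
Proof.
  unfold sec_defect; rewrite cos_0.
  enough (sec_partial_sum N 0 = 1) by lra.
  unfold sec_partial_sum; induction N as [|N IH].
  - rewrite sum_O, wallis_0; simpl; ring.
  - rewrite sum_Sn, IH, sin_0, pow_i by lia; at_R; ring.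
Qed.

Lemma pow_mul_compl_le (N : nat) (x : R) :
  0 <= x <= 1 -> (INR N + 1) * (x ^ N * (1 - x)) <= 1 - x ^ S N.
Proof.
  intros Hx; induction N as [|N IH].
  - simpl; lra.
  - rewrite S_INR.
    apply (Rmult_le_compat_l x) in IH; [|lra].
    assert (0 <= x ^ S N <= 1).
    { split; [apply pow_le; lra|].
      rewrite <- (pow1 (S N)); apply pow_incr; lra. }
    simpl pow in *. nra.
Qed.

(** Both bounds integrate the one-term derivative of [sec_defect] from 0.  The
    upper one uses (2N+1) x^N (1-x) <= 2 at x = sin^2 t, so that the derivative
    is at most that of 2 w_N tan t. *)
Lemma sec_defect_bounds (N : nat) (t : R) :
  0 <= t < PI / 2 -> 0 <= sec_defect N t <= 2 * wallis N * (sin t / cos t).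
Proof.
  intros Ht; pose proof PI_RGT_0 as Hpi.
  pose proof (wallis_pos N) as Hu; pose proof (pos_INR N) as HN.
  split.
  - rewrite <- (sec_defect_0 N).
    apply nondecreasing_of_derive_nonneg
      with (f := fun x => (2 * INR N + 1) * wallis N * sin x ^ (2 * N + 1)); [lra| |].
    + intros x _; apply is_derive_sec_defect.
    + intros x Hx; apply Rmult_le_pos; [apply Rmult_le_pos; lra|].
      apply pow_le, sin_ge_0; lra.
  - pose (F := fun x => 2 * wallis N * (sin x / cos x) - sec_defect N x).
    enough (H : F 0 <= F t).
    { unfold F in H; rewrite sec_defect_0, sin_0 in H.
      unfold Rdiv in *; lra. }
    apply nondecreasing_of_derive_nonneg
      with (f := fun x => 2 * wallis N * / (cos x * cos x)
                          - (2 * INR N + 1) * wallis N * sin x ^ (2 * N + 1)); [lra| |].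
    + intros x Hx.
      assert (Hc : 0 < cos x) by (apply cos_gt_0; lra).
      apply (is_derive_minus (fun x => 2 * wallis N * (sin x / cos x)));
        [|apply is_derive_sec_defect].
      auto_derive; [lra|].
      pose proof (sin2_cos2 x) as H; unfold Rsqr in H.
      transitivity (2 * wallis N * ((sin x * sin x + cos x * cos x)
                               / (cos x * cos x))); [field; lra|].
      rewrite H; field; lra.
    + intros x Hx.
      assert (Hc : 0 < cos x) by (apply cos_gt_0; lra).
      assert (Hs : 0 <= sin x) by (apply sin_ge_0; lra).
      pose proof (SIN_bound x) as Hs1.
      pose proof (sin2_cos2 x) as H; unfold Rsqr in H.
      assert (Hx2 : 0 <= sin x * sin x <= 1) by nra.
      pose proof (pow_mul_compl_le N _ Hx2) as Hp.
      assert (Hy : 0 <= (sin x * sin x) ^ S N) by (apply pow_le; lra).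
      assert (Hy' : 0 <= (sin x * sin x) ^ N) by (apply pow_le; lra).
      replace (1 - sin x * sin x) with (cos x * cos x) in Hp by lra.
      assert (Hcc : 0 < cos x * cos x) by nra.
      rewrite pow_add, pow_mult, pow_1.
      replace (sin x ^ 2) with (sin x * sin x) by ring.
      set (y := (sin x * sin x) ^ N) in *.
      set (c2 := cos x * cos x) in *.
      assert (Hyc : 0 <= y * c2) by nra.
      assert (Hb : (2 * INR N + 1) * (y * sin x) * c2 <= 2).
      { assert ((2 * INR N + 1) * (y * c2) <= 2) by nra.
        assert (0 <= (2 * INR N + 1) * (y * c2)) by nra.
        nra. }
      assert (Hdiv : (2 * INR N + 1) * (y * sin x) <= 2 * / c2).
      { apply (Rmult_le_reg_r c2); [lra|].
        replace (2 * / c2 * c2) with 2 by (field; lra); exact Hb. }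
      apply (Rmult_le_compat_l (wallis N)) in Hdiv; lra.
Qed.

Lemma is_RInt_sum_n (f : nat -> R -> R) (I : nat -> R) (a b : R) (N : nat) :
  (forall k, is_RInt (f k) a b (I k)) ->
  is_RInt (fun t => sum_n (fun k => f k t) N) a b (sum_n I N).
Proof.
  intros H; induction N as [|N IH].
  - rewrite sum_O; apply is_RInt_ext with (f O); [|apply H].
    intros x _; now rewrite sum_O.
  - rewrite sum_Sn.
    apply is_RInt_ext
      with (fun t => plus (sum_n (fun k => f k t) N) (f (S N) t)).
    + intros x _; now rewrite sum_Sn.
    + now apply (is_RInt_plus (V := R_NormedModule)).
Qed.

(** Multiplication by sin t turns the odd powers into the even ones of
    [sec_partial_sum]; the term n = 0 of the latter accounts for - cos t. *)
Lemma sin_mul_weighted_sum (N : nat) (t : R) :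
  sin t * sum_n (fun k => wallis (S k) * ((PI / 2 - t) * (sin t ^ (2 * k + 1) * cos t))) N
  = (PI / 2 - t) * (1 - cos t - sec_defect (S N) t).
Proof.
  unfold sec_defect, sec_partial_sum; induction N as [|N IH].
  - rewrite sum_Sn, !sum_O, wallis_0; at_R; ring.
  - rewrite sum_Sn, (sum_Sn _ (S N)).
    replace (2 * S (S N))%nat with (2 * S N + 1 + 1)%nat by lia.
    rewrite (pow_add _ (2 * S N + 1) 1).
    revert IH; unfold plus; cbn -[Nat.mul Nat.add pow sum_n wallis].
    intros IH; rewrite Rmult_plus_distr_l, IH; ring.
Qed.

(** The N-th partial sum, times PI/4, is the integral of a partial sum
    approximating (PI/2 - t) tan (t/2).  The pointwise error is
    (PI/2 - t) [sec_defect] / sin t <= 3 cos t * 2 w tan t / sin t = 6 w, with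
    w = w_(N+1) tending to 0. *)
Lemma is_series_wallis_sq_div_of_RInt (J : R) :
  is_RInt (fun t => (PI / 2 - t) * tan (t / 2)) 0 (PI / 2) J ->
  is_series (fun k => wallis (S k) ^ 2 / INR (S k)) (4 / PI * J).
Proof.
  intros HJ; pose proof PI_RGT_0 as Hpi.
  set (A := sum_n (fun k => wallis (S k) ^ 2 / INR (S k))).
  assert (HI : forall N, is_RInt (fun t => sum_n (fun k => wallis (S k)
                  * ((PI / 2 - t) * (sin t ^ (2 * k + 1) * cos t))) N)
                0 (PI / 2) (PI / 4 * A N)).
  { intros N.
    replace (PI / 4 * A N)
      with (sum_n (fun k => wallis (S k) * (PI / 4 * (wallis (S k) / INR (S k)))) N).
    - apply (is_RInt_sum_n (fun k t =>
        wallis (S k) * ((PI / 2 - t) * (sin t ^ (2 * k + 1) * cos t)))).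
      intros k; apply (is_RInt_scal (V := R_NormedModule)).
      apply is_RInt_compl_mul_sin_pow_cos.
    - unfold A; rewrite <- (sum_n_mult_l (K := R_Ring)).
      apply sum_n_ext; intros k; at_R; unfold Rdiv; ring. }
  assert (Hb : forall N, 0 <= J - PI / 4 * A N <= PI / 2 * (6 * wallis (S N))).
  { intros N.
    pose proof (is_RInt_minus _ _ _ _ _ _ HJ (HI N)) as HE.
    unfold minus, plus, opp in HE; simpl in HE.
    assert (Hpt : forall t, 0 < t < PI / 2 ->
      0 <= (PI / 2 - t) * tan (t / 2) - sum_n (fun k => wallis (S k)
             * ((PI / 2 - t) * (sin t ^ (2 * k + 1) * cos t))) N
        <= 6 * wallis (S N)).
    { intros t Ht.
      assert (Hc : 0 < cos t) by (apply cos_gt_0; lra).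
      assert (Hch : 0 < cos (t / 2)) by (apply cos_gt_0; lra).
      assert (Hs : 0 < sin t) by (apply sin_gt_0; lra).
      assert (H3 : PI / 2 - t <= 3 * cos t).
      { rewrite <- sin_shift; apply le_3_sin; lra. }
      destruct (sec_defect_bounds (S N) t) as [Hd0 Hd1]; [lra|].
      set (S0 := sum_n _ N).
      assert (HS : sin t * ((PI / 2 - t) * tan (t / 2) - S0)
                   = (PI / 2 - t) * sec_defect (S N) t).
      { unfold S0; rewrite Rmult_minus_distr_l, sin_mul_weighted_sum.
        replace (sin t * ((PI / 2 - t) * tan (t / 2)))
          with ((PI / 2 - t) * (1 - cos t)); [ring|].
        rewrite cos_half_double, (sin_half_double t); unfold tan.
        pose proof (sin2_cos2 (t / 2)) as H; unfold Rsqr in H.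
        replace (1 - (2 * cos (t / 2) * cos (t / 2) - 1))
          with (2 * (sin (t / 2) * sin (t / 2))) by lra.
        field; lra. }
      split; apply (Rmult_le_reg_l (sin t)); trivial; rewrite HS.
      - rewrite Rmult_0_r; apply Rmult_le_pos; lra.
      - pose proof (wallis_pos (S N)) as Hu.
        apply Rle_trans with (3 * cos t * (2 * wallis (S N) * (sin t / cos t))).
        + apply Rmult_le_compat; lra.
        + right; field; lra. }
    split.
    - replace 0 with (scal (PI / 2 - 0) 0) by (at_R; ring).
      refine (is_RInt_le _ _ 0 (PI / 2) _ _ _ (is_RInt_const _ _ _) HE _);
        [lra|]; intros t Ht; apply (Hpt t Ht).
    - replace (PI / 2 * (6 * wallis (S N))) with (scal (PI / 2 - 0) (6 * wallis (S N)))
        by (at_R; ring).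
      refine (is_RInt_le _ _ 0 (PI / 2) _ _ _ HE (is_RInt_const _ _ _) _);
        [lra|]; intros t Ht; apply (Hpt t Ht). }
  change (is_lim_seq A (4 / PI * J)).
  apply is_lim_seq_le_le
    with (u := fun N => 4 / PI * J - 12 * wallis (S N)) (w := fun _ => 4 / PI * J).
  - intros N; specialize (Hb N).
    split; apply (Rmult_le_reg_l (PI / 4)); try lra.
    + replace (PI / 4 * (4 / PI * J - 12 * wallis (S N)))
        with (J - PI / 2 * (6 * wallis (S N))) by (field; lra); lra.
    + replace (PI / 4 * (4 / PI * J)) with J by (field; lra); lra.
  - replace (Finite (4 / PI * J)) with (Finite (4 / PI * J - 12 * 0))
      by (f_equal; ring).
    apply is_lim_seq_minus'; [apply is_lim_seq_const|].
    apply (is_lim_seq_scal_l (fun N => wallis (S N)) 12 0).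
    apply (is_lim_seq_incr_1 wallis), is_lim_seq_wallis.
  - apply is_lim_seq_const.
Qed.

(** * Evaluation of the integral of (PI/2 - t) tan (t/2) *)

(** Integrating the finite geometric series of 1 / (1+x) over [0, 1] leaves an
    error at most the integral of x^(N+1). *)
Lemma alternating_harmonic_series :
  is_series (fun k => (-1) ^ k / (INR k + 1)) (ln 2).
Proof.
  change (is_lim_seq (sum_n (fun k => (-1) ^ k / (INR k + 1))) (ln 2)).
  set (S := sum_n (fun k => (-1) ^ k / (INR k + 1))).
  assert (Hln : is_RInt (fun x => / (1 + x)) 0 1 (ln 2)).
  { replace (ln 2) with (ln (1 + 1) - ln (1 + 0)).
    2:{ rewrite Rplus_0_r, ln_1, Rminus_0_r; f_equal; ring. }
    apply (is_RInt_of_antiderivative (fun x => ln (1 + x))); [lra| |];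
      intros x Hx; auto_derive; lra. }
  assert (HS : forall N, is_RInt (fun x => sum_n (fun k => (-1) ^ k * x ^ k) N)
                           0 1 (S N)).
  { intros N; apply (is_RInt_sum_n (fun k x => (-1) ^ k * x ^ k)); intros k.
    apply (is_RInt_scal (V := R_NormedModule)).
    pose proof (pos_INR k) as Hk.
    replace (/ (INR k + 1))
      with (/ (INR k + 1) * 1 ^ (k + 1) - / (INR k + 1) * 0 ^ (k + 1)).
    2:{ rewrite pow1, pow_i by lia; ring. }
    apply (is_RInt_of_antiderivative (fun x => / (INR k + 1) * x ^ (k + 1)));
      [lra| |]; intros x Hx; auto_derive; trivial.
    replace (Nat.pred (k + 1)) with k by lia.
    rewrite plus_INR; simpl (INR 1); field; lra. }
  assert (Hgeom : forall x N, 0 <= x ->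
    / (1 + x) - sum_n (fun k => (-1) ^ k * x ^ k) N
    = (-1) ^ (N + 1) * (x ^ (N + 1) / (1 + x))).
  { intros x N Hx; induction N as [|N IH].
    - rewrite sum_O; simpl; field; lra.
    - rewrite sum_Sn; unfold plus; cbn -[pow sum_n Nat.add].
      rewrite Rminus_plus_distr, IH.
      replace (Datatypes.S N + 1)%nat with (N + 2)%nat by lia.
      replace (Datatypes.S N) with (N + 1)%nat by lia.
      rewrite !pow_add; simpl; field; lra. }
  assert (Hb : forall N, Rabs (ln 2 - S N) <= / (1 * INR N + 2)).
  { intros N; pose proof (pos_INR N) as HN.
    apply (norm_RInt_le (V := R_NormedModule)
             (fun x => minus (/ (1 + x)) (sum_n (fun k => (-1) ^ k * x ^ k) N))
             (fun x => x ^ (N + 1)) 0 1); [lra| | |].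
    - intros x Hx; unfold minus, plus, opp, norm; simpl.
      change (Rabs (/ (1 + x) - sum_n (fun k => (-1) ^ k * x ^ k) N)
              <= x ^ (N + 1)).
      rewrite Hgeom, Rabs_mult, pow_1_abs, Rmult_1_l by lra.
      assert (H0 : 0 <= x ^ (N + 1)) by (apply pow_le; lra).
      rewrite Rabs_pos_eq.
      + apply (Rmult_le_reg_r (1 + x)); [lra|].
        unfold Rdiv; rewrite Rmult_assoc, Rinv_l by lra; nra.
      + apply Rmult_le_pos; [lra|].
        left; apply Rinv_0_lt_compat; lra.
    - apply (is_RInt_minus (V := R_NormedModule)); [exact Hln|apply HS].
    - replace (/ (1 * INR N + 2))
        with (/ (INR N + 2) * 1 ^ (N + 2) - / (INR N + 2) * 0 ^ (N + 2)).
      2:{ rewrite pow1, pow_i by lia; field; lra. }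
      apply (is_RInt_of_antiderivative (fun x => / (INR N + 2) * x ^ (N + 2)));
        [lra| |]; intros x Hx; auto_derive; trivial.
      replace (Nat.pred (N + 2)) with (N + 1)%nat by lia.
      rewrite plus_INR; simpl (INR 2); field; lra. }
  apply is_lim_seq_le_le
    with (u := fun N => ln 2 - / (1 * INR N + 2))
         (w := fun N => ln 2 + / (1 * INR N + 2)).
  - intros N; specialize (Hb N); apply Rabs_le_between in Hb; lra.
  - replace (Finite (ln 2)) with (Finite (ln 2 - 0)) by (f_equal; ring).
    apply is_lim_seq_minus'; [apply is_lim_seq_const|].
    apply is_lim_seq_inv_INR_affine; lra.
  - replace (Finite (ln 2)) with (Finite (ln 2 + 0)) by (f_equal; ring).
    apply is_lim_seq_plus'; [apply is_lim_seq_const|].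
    apply is_lim_seq_inv_INR_affine; lra.
Qed.

Lemma is_RInt_compl_mul_sin (c : R) :
  0 < c ->
  is_RInt (fun t => (PI / 2 - t) * sin (c * t)) 0 (PI / 2)
    (PI / (2 * c) - sin (c * (PI / 2)) / c ^ 2).
Proof.
  intros Hc; pose proof PI_RGT_0 as Hpi.
  set (F := fun t => - (PI / 2 - t) * cos (c * t) / c - sin (c * t) / c ^ 2).
  replace (PI / (2 * c) - sin (c * (PI / 2)) / c ^ 2) with (F (PI / 2) - F 0).
  2:{ unfold F; rewrite Rmult_0_r, sin_0, cos_0; field; lra. }
  apply is_RInt_of_antiderivative; [lra| |].
  - intros x _; unfold F; auto_derive; [repeat split; lra|field; lra].
  - intros x _; auto_derive; easy.
Qed.

(** The analogue for alternating signs of the conjugate Dirichlet kernel: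
    2 cos (t/2) sin kt = sin (k + 1/2) t + sin (k - 1/2) t telescopes. *)
Lemma alternating_sine_sum (t : R) (N : nat) :
  cos (t / 2) * sum_n (fun k => 2 * (-1) ^ k * sin ((INR k + 1) * t)) N
  = sin (t / 2) + (-1) ^ N * sin ((INR N + 3 / 2) * t).
Proof.
  assert (H : forall k, 2 * (cos (t / 2) * sin ((INR k + 1) * t))
                 = sin ((INR k + 3 / 2) * t) + sin ((INR k + 1 / 2) * t)).
  { intros k.
    replace ((INR k + 3 / 2) * t) with ((INR k + 1) * t + t / 2) by field.
    replace ((INR k + 1 / 2) * t) with ((INR k + 1) * t - t / 2) by field.
    rewrite sin_plus, sin_minus; ring. }
  induction N as [|N IH].
  - rewrite sum_O.
    transitivity (2 * (cos (t / 2) * sin ((INR 0 + 1) * t))); [simpl; ring|].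
    rewrite H; simpl.
    replace ((0 + 1 / 2) * t) with (t / 2) by field; ring.
  - rewrite sum_Sn; unfold plus; cbn -[pow sum_n INR].
    rewrite Rmult_plus_distr_l, IH.
    transitivity (sin (t / 2) + (-1) ^ N * sin ((INR N + 3 / 2) * t)
      + (-1) ^ S N * (2 * (cos (t / 2) * sin ((INR (S N) + 1) * t)))); [ring|].
    rewrite H, S_INR.
    replace ((INR N + 1 + 1 / 2) * t) with ((INR N + 3 / 2) * t) by field.
    simpl; ring.
Qed.

(** A quantitative Riemann-Lebesgue lemma, by one integration by parts: the
    amplitude (PI/2 - t) / cos (t/2) vanishes at PI/2, is PI/2 at 0 and has a
    derivative bounded by 6, which leaves (PI/2 + 6 PI/2) / w <= 20 / w. *)
Lemma oscillating_remainder_bound (w I : R) :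
  0 < w ->
  is_RInt (fun t => (PI / 2 - t) / cos (t / 2) * sin (w * t)) 0 (PI / 2) I ->
  Rabs I <= 20 / w.
Proof.
  intros Hw HI.
  pose proof PI_RGT_0 as Hpi; pose proof PI_4 as Hpi4.
  (* phi' is the derivative of the amplitude (PI/2 - t) / cos (t/2). *)
  pose (phi' := fun t => - / cos (t / 2)
                 + (PI / 2 - t) * sin (t / 2) / (2 * cos (t / 2) ^ 2)).
  pose (F := fun t => - ((PI / 2 - t) / cos (t / 2) * cos (w * t) / w)).
  assert (Hch : forall t, 0 <= t <= PI / 2 -> / 2 <= cos (t / 2)).
  { intros t Ht.
    assert (H : 0 <= cos t) by (apply cos_ge_0; lra).
    assert (Hp : 0 <= cos (t / 2)) by (apply cos_ge_0; lra).
    rewrite cos_half_double in H; nra. }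
  assert (HD : is_RInt (fun t => (PI / 2 - t) / cos (t / 2) * sin (w * t)
                                 - phi' t * cos (w * t) / w) 0 (PI / 2)
                 (F (PI / 2) - F 0)).
  { apply is_RInt_of_antiderivative; [lra| |].
    - intros x Hx; specialize (Hch x Hx).
      unfold F, phi'; auto_derive; [lra|].
      change (x * / 2) with (x / 2); field; lra.
    - intros x Hx; specialize (Hch x Hx); unfold phi'; auto_derive.
      repeat split; try lra. all: try (apply Rgt_not_eq; nra). }
  pose proof (is_RInt_minus _ _ _ _ _ _ HI HD) as HR.
  assert (HF : F (PI / 2) - F 0 = PI / 2 / w).
  { unfold F; replace (0 / 2) with 0 by field.
    rewrite Rmult_0_r, cos_0.
    pose proof (Hch (PI / 2) ltac:(lra)); field; lra. }
  assert (Hphi : forall t, 0 <= t <= PI / 2 -> Rabs (phi' t) <= 6).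
  { intros t Ht; pose proof (Hch t Ht) as Hc.
    assert (H1 : / cos (t / 2) <= 2).
    { replace 2 with (/ / 2) at 2 by apply Rinv_inv.
      apply Rinv_le_contravar; [lra|exact Hc]. }
    assert (H0 : 0 < / cos (t / 2)) by (apply Rinv_0_lt_compat; lra).
    assert (Hs : 0 <= sin (t / 2)) by (apply sin_ge_0; lra).
    pose proof (SIN_bound (t / 2)) as Hs1.
    assert (Hps : 0 <= (PI / 2 - t) * sin (t / 2) <= 2) by nra.
    unfold phi'.
    replace ((PI / 2 - t) * sin (t / 2) / (2 * cos (t / 2) ^ 2))
      with (/ 2 * ((PI / 2 - t) * sin (t / 2))
            * (/ cos (t / 2) * / cos (t / 2))) by (field; lra).
    set (y := / cos (t / 2)) in *.
    set (p := (PI / 2 - t) * sin (t / 2)) in *.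
    assert (0 <= y * y <= 4) by nra.
    apply Rabs_le; nra. }
  assert (Hrem : Rabs (I - PI / 2 / w) <= (PI / 2 - 0) * (6 / w)).
  { rewrite <- HF.
    refine (norm_RInt_le_const (V := R_NormedModule) _ 0 (PI / 2) _ (6 / w)
              _ _ HR); [lra|].
    intros t Ht.
    match goal with |- norm ?a <= _ =>
      replace a with (phi' t * cos (w * t) / w)
        by (unfold minus, plus, opp; simpl; ring) end.
    change (Rabs (phi' t * cos (w * t) / w) <= 6 / w).
    unfold Rdiv; rewrite !Rabs_mult.
    rewrite (Rabs_pos_eq (/ w)) by (left; now apply Rinv_0_lt_compat).
    apply Rmult_le_compat_r; [left; now apply Rinv_0_lt_compat|].
    pose proof (Rabs_pos (phi' t)); pose proof (Rabs_pos (cos (w * t))).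
    pose proof (Hphi t Ht).
    assert (Rabs (cos (w * t)) <= 1)
      by (apply Rabs_le; apply COS_bound).
    nra. }
  assert (Hiw : 0 < / w) by now apply Rinv_0_lt_compat.
  unfold Rdiv in *.
  apply Rabs_le_between in Hrem.
  assert (PI * / w <= 4 * / w) by nra.
  assert (0 < PI * / w) by nra.
  apply Rabs_le; lra.
Qed.

Lemma sin_half_turns_odd (j : nat) : sin ((2 * INR j + 1) * (PI / 2)) = (-1) ^ j.
Proof.
  induction j as [|j IH].
  - simpl; replace ((2 * 0 + 1) * (PI / 2)) with (PI / 2) by field.
    apply sin_PI2.
  - rewrite S_INR.
    replace ((2 * (INR j + 1) + 1) * (PI / 2))
      with ((2 * INR j + 1) * (PI / 2) + PI) by field.
    rewrite neg_sin, IH; simpl; ring.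
Qed.

Lemma sin_half_turns_even (j : nat) : sin (2 * INR j * (PI / 2)) = 0.
Proof.
  induction j as [|j IH].
  - simpl; rewrite Rmult_0_r, Rmult_0_l; apply sin_0.
  - rewrite S_INR.
    replace (2 * (INR j + 1) * (PI / 2)) with (2 * INR j * (PI / 2) + PI) by field.
    rewrite neg_sin, IH; ring.
Qed.

(** Only odd multiples of PI/2 contribute, so 2m + 1 terms collapse to the
    first m + 1 terms of the series of Catalan's constant. *)
Lemma sum_sin_half_turns (m : nat) :
  sum_n (fun k => (-1) ^ k * sin ((INR k + 1) * (PI / 2)) / (INR k + 1) ^ 2)
    (2 * m)
  = sum_n (fun j => (-1) ^ j / (2 * INR j + 1) ^ 2) m.
Proof.
  induction m as [|m IH].
  - simpl Nat.mul; rewrite !sum_O; simpl.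
    replace ((0 + 1) * (PI / 2)) with (PI / 2) by field.
    rewrite sin_PI2; field.
  - replace (2 * S m)%nat with (S (S (2 * m))) by lia.
    rewrite !sum_Sn, IH.
    cbv beta; rewrite !S_INR, INR_double.
    replace ((2 * INR m + 1 + 1) * (PI / 2))
      with (2 * INR (S m) * (PI / 2)) by (rewrite S_INR; ring).
    replace ((2 * INR m + 1 + 1 + 1) * (PI / 2))
      with ((2 * INR (S m) + 1) * (PI / 2)) by (rewrite S_INR; ring).
    rewrite sin_half_turns_even, sin_half_turns_odd.
    replace (S (S (2 * m))) with (2 * S m)%nat by lia.
    rewrite pow_1_even.
    replace (2 * INR m + 1 + 1 + 1) with (2 * (INR m + 1) + 1) by ring.
    unfold plus; cbn -[pow sum_n]; unfold Rdiv; ring.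
Qed.

(** Integrating the sine expansion of tan (t/2) term by term shows that
    PI H_N - 2 G_N tends to the integral J, where H_N and G_N are partial sums
    of the series of ln 2 and of Catalan's constant.  As H_N tends to ln 2,
    this yields both the convergence of the series of Catalan's constant and
    its value in terms of J. *)
Lemma is_RInt_compl_mul_tan_half :
  is_RInt (fun t => (PI / 2 - t) * tan (t / 2)) 0 (PI / 2)
    (PI * ln 2 - 2 * Catalan).
Proof.
  pose proof PI_RGT_0 as Hpi.
  assert (Hch : forall t, 0 <= t <= PI / 2 -> 0 < cos (t / 2)).
  { intros t Ht; apply cos_gt_0; lra. }
  assert (Hex : ex_RInt (fun t => (PI / 2 - t) * tan (t / 2)) 0 (PI / 2)).
  { apply (ex_RInt_continuous (V := R_CompleteNormedModule)).
    rewrite Rmin_left, Rmax_right by lra; intros t Ht.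
    apply (ex_derive_continuous (fun t => (PI / 2 - t) * tan (t / 2))).
    unfold tan; auto_derive.
    specialize (Hch t Ht); lra. }
  destruct Hex as [J HJ].
  set (H := sum_n (fun k => (-1) ^ k / (INR k + 1))).
  set (G := sum_n (fun k => (-1) ^ k * sin ((INR k + 1) * (PI / 2))
                            / (INR k + 1) ^ 2)).
  assert (HS : forall N, is_RInt (fun t => sum_n (fun k => 2 * (-1) ^ k
                   * ((PI / 2 - t) * sin ((INR k + 1) * t))) N)
                 0 (PI / 2) (PI * H N - 2 * G N)).
  { intros N.
    replace (PI * H N - 2 * G N)
      with (sum_n (fun k => 2 * (-1) ^ k * (PI / (2 * (INR k + 1))
              - sin ((INR k + 1) * (PI / 2)) / (INR k + 1) ^ 2)) N).
    - apply (is_RInt_sum_n (fun k t => 2 * (-1) ^ k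
               * ((PI / 2 - t) * sin ((INR k + 1) * t)))).
      intros k; apply (is_RInt_scal (V := R_NormedModule)).
      apply is_RInt_compl_mul_sin; pose proof (pos_INR k); lra.
    - unfold H, G; induction N as [|N IH].
      + rewrite !sum_O; simpl; field.
      + rewrite !sum_Sn, IH; unfold plus; cbn -[pow sum_n INR].
        pose proof (pos_INR (S N)); field; lra. }
  assert (Hb : forall N, Rabs (J - (PI * H N - 2 * G N)) <= 20 / (INR N + 3 / 2)).
  { intros N; pose proof (pos_INR N) as HN.
    set (D := J - (PI * H N - 2 * G N)).
    assert (HD : Rabs ((-1) ^ S N * D) <= 20 / (INR N + 3 / 2)).
    { apply oscillating_remainder_bound; [lra|].
      pose proof (is_RInt_minus _ _ _ _ _ _ HJ (HS N)) as HE.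
      apply (is_RInt_scal _ _ _ ((-1) ^ S N)) in HE.
      revert HE; apply is_RInt_ext.
      rewrite Rmin_left, Rmax_right by lra; intros t Ht.
      pose proof (Hch t ltac:(lra)) as Hc.
      assert (Hsum : sum_n (fun k => 2 * (-1) ^ k
                * ((PI / 2 - t) * sin ((INR k + 1) * t))) N
              = (PI / 2 - t) * sum_n (fun k => 2 * (-1) ^ k
                                        * sin ((INR k + 1) * t)) N).
      { rewrite <- (sum_n_mult_l (K := R_Ring)); apply sum_n_ext; intros k.
        at_R; ring. }
      rewrite Hsum.
      pose proof (alternating_sine_sum t N) as HK.
      set (T := sum_n _ N) in HK |- *.
      assert (HT : T = (sin (t / 2) + (-1) ^ N * sin ((INR N + 3 / 2) * t))
                       / cos (t / 2)).
      { apply (Rmult_eq_reg_l (cos (t / 2))); [|lra].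
        rewrite HK; field; lra. }
      rewrite HT.
      assert (Hsq : (-1) ^ N * (-1) ^ N = 1).
      { rewrite <- Rpow_mult_distr; replace (-1 * -1) with 1 by ring.
        apply pow1. }
      unfold tan, scal, minus, plus, opp, mult; simpl; unfold mult; simpl.
      lazymatch goal with |- @eq _ ?a ?b => change (@eq R a b) end.
      transitivity (((-1) ^ N * (-1) ^ N) * ((PI / 2 - t) / cos (t / 2)
                    * sin ((INR N + 3 / 2) * t))); [field; lra|].
      rewrite Hsq; ring. }
    rewrite Rabs_mult, pow_1_abs, Rmult_1_l in HD; exact HD. }
  assert (Hlim : is_lim_seq (fun N => PI * H N - 2 * G N) J).
  { assert (H20 : is_lim_seq (fun N => 20 / (INR N + 3 / 2)) 0).
    { apply is_lim_seq_ext with (fun N => 20 * / (1 * INR N + 3 / 2)).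
      - intros N; pose proof (pos_INR N); field; lra.
      - replace (Finite 0) with (Finite (20 * 0)) by (f_equal; ring).
        apply (is_lim_seq_scal_l _ 20 0), is_lim_seq_inv_INR_affine; lra. }
    apply is_lim_seq_le_le
      with (u := fun N => J - 20 / (INR N + 3 / 2))
           (w := fun N => J + 20 / (INR N + 3 / 2)).
    - intros N; specialize (Hb N); apply Rabs_le_between in Hb; lra.
    - replace (Finite J) with (Finite (J - 0)) by (f_equal; ring).
      apply is_lim_seq_minus'; [apply is_lim_seq_const|exact H20].
    - replace (Finite J) with (Finite (J + 0)) by (f_equal; ring).
      apply is_lim_seq_plus'; [apply is_lim_seq_const|exact H20]. }
  assert (HG : is_lim_seq G ((PI * ln 2 - J) / 2)).
  { apply is_lim_seq_ext
      with (fun N => (PI * H N - (PI * H N - 2 * G N)) * / 2).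
    - intros N; field.
    - apply (is_lim_seq_scal_r _ (/ 2) (PI * ln 2 - J)), is_lim_seq_minus';
        [|exact Hlim].
      apply (is_lim_seq_scal_l H PI (ln 2)), alternating_harmonic_series. }
  assert (HC : Catalan = (PI * ln 2 - J) / 2).
  { unfold Catalan; apply is_series_unique.
    change (is_lim_seq (sum_n (fun n => (-1) ^ n / (2 * INR n + 1) ^ 2))
              ((PI * ln 2 - J) / 2)).
    apply is_lim_seq_ext with (fun m => G (2 * m)%nat).
    - intros m; apply sum_sin_half_turns.
    - apply (is_lim_seq_subseq G _ (fun m => (2 * m)%nat)); [|exact HG].
      apply eventually_subseq; intros m; lia. }
  assert (HJC : PI * ln 2 - 2 * Catalan = J :> R) by (rewrite HC; at_R; field).
  rewrite HJC; exact HJ.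
Qed.

Lemma is_series_wallis_sq_div :
  is_series (fun k => wallis (S k) ^ 2 / INR (S k)) (4 * ln 2 - 8 * (Catalan / PI)).
Proof.
  pose proof PI_RGT_0 as Hpi.
  replace (4 * ln 2 - 8 * (Catalan / PI))
    with (4 / PI * (PI * ln 2 - 2 * Catalan)) by (field; lra).
  apply is_series_wallis_sq_div_of_RInt, is_RInt_compl_mul_tan_half.
Qed.

(** * Evaluation of the hypergeometric series *)

Lemma pochhammer_S (a : R) (k : nat) :
  pochhammer a (S k) = a * pochhammer (a + 1) k.
Proof.
  induction k as [|k IH].
  - simpl; ring.
  - change (pochhammer a (S (S k))) with (pochhammer a (S k) * (a + INR (S k))).
    rewrite IH, S_INR; simpl; ring.
Qed.

Lemma pochhammer_1 (k : nat) : pochhammer 1 k = INR (fact k).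
Proof.
  induction k as [|k IH]; [easy|].
  rewrite fact_simpl, mult_INR, S_INR, <- IH; simpl; ring.
Qed.

Lemma pochhammer_2 (k : nat) : pochhammer 2 k = (INR k + 1) * INR (fact k).
Proof.
  pose proof (pochhammer_S 1 k) as H.
  replace (1 + 1) with 2 in H by ring.
  rewrite <- pochhammer_1; simpl in H; lra.
Qed.

Lemma pochhammer_3 (k : nat) :
  pochhammer 3 k = (INR k + 1) * (INR k + 2) * INR (fact k) / 2.
Proof.
  pose proof (pochhammer_S 2 k) as H.
  replace (2 + 1) with 3 in H by ring.
  simpl in H; rewrite pochhammer_2 in H; lra.
Qed.

Lemma pochhammer_4 (k : nat) :
  pochhammer 4 k = (INR k + 1) * (INR k + 2) * (INR k + 3) * INR (fact k) / 6.
Proof.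
  pose proof (pochhammer_S 3 k) as H.
  replace (3 + 1) with 4 in H by ring.
  simpl in H; rewrite pochhammer_3 in H; lra.
Qed.

Lemma pochhammer_3_2 (k : nat) :
  pochhammer (3 / 2) k = 2 * (INR k + 1) * INR (fact k) * wallis (S k).
Proof.
  pose proof (pochhammer_S (1 / 2) k) as H.
  replace (1 / 2 + 1) with (3 / 2) in H by field.
  unfold wallis; rewrite fact_simpl, mult_INR, S_INR, H.
  pose proof (pos_INR k); pose proof (INR_fact_neq_0 k).
  field; split; lra.
Qed.

Lemma is_lim_seq_mul_wallis_sq (p : nat -> R) (c : R) :
  is_lim_seq (fun k => p (S k) / INR (S k)) c ->
  is_lim_seq (fun n => p n * wallis n ^ 2) (c / PI).
Proof.
  intros Hp; apply is_lim_seq_incr_1.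
  apply is_lim_seq_ext
    with (fun k => p (S k) / INR (S k) * (INR (S k) * wallis (S k) ^ 2)).
  - intros k; rewrite S_INR; pose proof (pos_INR k); field; lra.
  - apply (is_lim_seq_mult' _ _ c (/ PI)); [exact Hp|].
    apply (is_lim_seq_incr_1 (fun n => INR n * wallis n ^ 2)), wallis_limit.
Qed.

Lemma is_series_of_telescoping (c p : nat -> R) (l : R) :
  (forall k, c k = p (S k) - p k) ->
  is_lim_seq p l ->
  is_series c (l - p O).
Proof.
  intros Hc Hp.
  change (is_lim_seq (sum_n c) (l - p O)).
  apply is_lim_seq_ext with (fun N => p (S N) - p O).
  - intros N; induction N as [|N IH].
    + now rewrite sum_O, Hc.
    + rewrite sum_Sn, <- IH, Hc; at_R; ring.
  - apply is_lim_seq_minus'; [|apply is_lim_seq_const].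
    now apply is_lim_seq_incr_1 in Hp.
Qed.

(** The common shape of the three evaluations: a multiple of w_n^2 / n minus
    the increment of p(n) w_n^2, at n = k + 1.  The telescoping part starts at
    n = 1, where w_1^2 = 1/4. *)
Lemma hyp4F3_at_1 (b1 b2 b3 a c l : R) (p : nat -> R) :
  (forall k, hyp4F3_coef 1 1 (3 / 2) (3 / 2) b1 b2 b3 k
     = a * (wallis (S k) ^ 2 / INR (S k))
       - (p (S (S k)) * wallis (S (S k)) ^ 2 - p (S k) * wallis (S k) ^ 2)) ->
  is_lim_seq (fun k => p (S k) / INR (S k)) c ->
  l = a * (4 * ln 2 - 8 * (Catalan / PI)) - (c / PI - p 1%nat / 4) ->
  hyp4F3_cv 1 1 (3 / 2) (3 / 2) b1 b2 b3 1 /\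
  hyp4F3 1 1 (3 / 2) (3 / 2) b1 b2 b3 1 = l.
Proof.
  intros Hcoef Hp Hl.
  enough (H : is_pseries (hyp4F3_coef 1 1 (3 / 2) (3 / 2) b1 b2 b3) 1 l).
  { split; [now exists l|now apply is_pseries_unique]. }
  apply is_pseries_R.
  pose (q := fun k => p (S k) * wallis (S k) ^ 2).
  assert (Hq : is_series (fun k => q (S k) - q k) (c / PI - q O)).
  { apply is_series_of_telescoping; [easy|].
    apply (is_lim_seq_incr_1 (fun n => p n * wallis n ^ 2)).
    now apply is_lim_seq_mul_wallis_sq. }
  assert (Hq0 : q O = p 1%nat / 4).
  { unfold q; rewrite wallis_S, wallis_0; simpl; field. }
  rewrite Hq0 in Hq.
  pose proof (is_series_scal a _ _ is_series_wallis_sq_div) as HA.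
  pose proof (is_series_minus _ _ _ _ HA Hq) as H.
  rewrite Hl; revert H; apply is_series_ext; intros k.
  rewrite Hcoef, pow1; unfold q; at_R; ring.
Qed.

Theorem theorem3p1 :
  (hyp4F3_cv 1 1 (3 / 2) (3 / 2) 2 2 3 1 /\
   hyp4F3 1 1 (3 / 2) (3 / 2) 2 2 3 1
   = 8 + 32 * ln 2 - 64 * (Catalan / PI) - 32 / PI) /\
  (hyp4F3_cv 1 1 (3 / 2) (3 / 2) 2 3 3 1 /\
   hyp4F3 1 1 (3 / 2) (3 / 2) 2 3 3 1
   = 96 + 64 * ln 2 - 128 * (Catalan / PI) - 320 / PI) /\
  (hyp4F3_cv 1 1 (3 / 2) (3 / 2) 2 2 4 1 /\
   hyp4F3 1 1 (3 / 2) (3 / 2) 2 2 4 1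
   = 18 + 48 * ln 2 - 96 * (Catalan / PI) - 208 / (3 * PI)).
Proof.
  pose proof PI_RGT_0 as Hpi.
  assert (Hlim : forall a b d : R,
    is_lim_seq (fun k => a + b * / (1 * INR k + d)) a).
  { intros a b d.
    replace (Finite a) with (Finite (a + b * 0)) by (f_equal; ring).
    apply is_lim_seq_plus'; [apply is_lim_seq_const|].
    apply (is_lim_seq_scal_l _ b 0), is_lim_seq_inv_INR_affine; lra. }
  split; [|split].
  (* 8 / (n (n+1)) = 8 / n - 8 / (n+1), so p(n) = 8 * 4 n. *)
  - apply hyp4F3_at_1 with (a := 8) (c := 32) (p := fun n => 32 * INR n).
    + intros k; unfold hyp4F3_coef.
      rewrite (wallis_S (S k)), pochhammer_1, pochhammer_2, pochhammer_3,
        pochhammer_3_2, !S_INR.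
      pose proof (pos_INR k); pose proof (INR_fact_neq_0 k).
      field; repeat split; lra.
    + apply is_lim_seq_ext with (fun _ => 32); [|apply is_lim_seq_const].
      intros k; rewrite S_INR; pose proof (pos_INR k); field; lra.
    + simpl; field; lra.
  (* 16 / (n (n+1)^2) = 16 / n - 16 / (n+1) - 16 / (n+1)^2, so
     p(n) = 16 * 4 n + 16 (16 n + 4) = 320 n + 64. *)
  - apply hyp4F3_at_1
      with (a := 16) (c := 320) (p := fun n => 320 * INR n + 64).
    + intros k; unfold hyp4F3_coef.
      rewrite (wallis_S (S k)), pochhammer_1, pochhammer_2, pochhammer_3,
        pochhammer_3_2, !S_INR.
      pose proof (pos_INR k); pose proof (INR_fact_neq_0 k).
      field; repeat split; lra.
    + apply is_lim_seq_ext with (fun k => 320 + 64 * / (1 * INR k + 1));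
        [|apply Hlim].
      intros k; rewrite S_INR; pose proof (pos_INR k); field; lra.
    + simpl; field; lra.
  (* 24 / (n (n+1) (n+2)) = 12 / n - 24 / (n+1) + 12 / (n+2), so
     p(n) = 24 * 4 n - 12 n (20 n + 16) / (9 (n+1)). *)
  - apply hyp4F3_at_1 with (a := 12) (c := 208 / 3)
      (p := fun n => 96 * INR n
                     - 4 / 3 * INR n * (20 * INR n + 16) / (INR n + 1)).
    + intros k; unfold hyp4F3_coef.
      rewrite (wallis_S (S k)), pochhammer_1, pochhammer_2, pochhammer_4,
        pochhammer_3_2, !S_INR.
      pose proof (pos_INR k); pose proof (INR_fact_neq_0 k).
      field; repeat split; lra.
    + apply is_lim_seq_ext
        with (fun k => 208 / 3 + 16 / 3 * / (1 * INR k + 2)); [|apply Hlim].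
      intros k; rewrite S_INR; pose proof (pos_INR k); field; split; lra.
    + simpl; field; lra.
Qed.
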